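(* For every positive integer $n<\infty$, there exists an element $a\in C^*(\mathbb{F}_n)\setminus\mathbb{C}\mathbb{F}_n$ that achieves its norm under some finite-dimensional representation, i.e. there is a finite-dimensional representation $\pi$ of $C^*(\mathbb{F}_n)$ with $\|\pi(a)\|=\|a\|$.
   Context: $\mathbb{F}_n$ is the free group on $n$ generators, $\mathbb{C}\mathbb{F}_n$ its complex group algebra, viewed as a dense $*$-subalgebra of the full group $C^*$-algebra $C^*(\mathbb{F}_n)$. *)

(* Defs.v *)
From HB Require Import structures.
From mathcomp Require Import all_boot all_order all_algebra.
From mathcomp Require Import finmap sesquilinear complex.
From mathcomp Require Import all_classical all_reals all_analysis.

Set Implicit Arguments.
Unset Strict Implicit.
Unset Printing Implicit Defensive.

Import Order.TTheory GRing.Theory Num.Theory.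
Import numFieldNormedType.Exports.

Local Open Scope classical_set_scope.
Local Open Scope ring_scope.

(* The free group on n generators, as reduced words; the letter (i, true) is
   the i-th generator and (i, false) is its inverse. *)
Section FreeGroup.
Variable n : nat.

Definition letter : Type := ('I_n * bool)%type.
Implicit Types (x y : letter) (s t u : seq letter).

Definition letter_inv x : letter := (x.1, ~~ x.2).

Definition reduced s := sorted (fun x y => y != letter_inv x) s.

(* The reduced form of x :: s, for s reduced. *)
Definition push x s :=
  if s is y :: s' then if y == letter_inv x then s' else x :: s else [:: x].

Definition word_mul s t := foldr push t s.
Definition word_inv s := rev (map letter_inv s).

Lemma letter_invK : involutive letter_inv.
Proof. by case=> i b; rewrite /letter_inv /= negbK. Qed.

Lemma push_reduced x s : reduced s -> reduced (push x s).
Proof.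
case: s => //= y s; case: ifP => [_ /path_sorted //|/negbT yx ys].
by rewrite /reduced /= yx.
Qed.

Lemma pushK x s : reduced s -> push x (push (letter_inv x) s) = s.
Proof.
case: s => [|y s] /=; first by rewrite eqxx.
rewrite letter_invK; case: eqP => [->|_ _] /=; last by rewrite eqxx.
by case: s => //= z s /andP[/negbTE-> _].
Qed.

Lemma push_path x s : reduced (x :: s) -> push x s = x :: s.
Proof. by case: s => //= y s /andP[/negbTE-> _]. Qed.

Lemma word_mul_reduced s t : reduced t -> reduced (word_mul s t).
Proof. by move=> tr; elim: s => //= x s; apply: push_reduced. Qed.

Lemma word_mul_push x s t :
  reduced t -> word_mul (push x s) t = push x (word_mul s t).
Proof.
move=> tr; case: s => //= y s; case: ifP => //= /eqP->.
by rewrite pushK// word_mul_reduced.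
Qed.

Lemma word_mulA s t u :
  reduced u -> word_mul s (word_mul t u) = word_mul (word_mul s t) u.
Proof. by move=> ur; elim: s => //= x s ->; rewrite word_mul_push. Qed.

Lemma word_muls0 s : reduced s -> word_mul s [::] = s.
Proof.
elim: s => //= x s IHs xs.
by rewrite -/(word_mul _ _) IHs ?push_path//; apply: path_sorted xs.
Qed.

Lemma word_invK : involutive word_inv.
Proof. by move=> s; rewrite /word_inv map_rev revK mapK//; apply: letter_invK. Qed.

Lemma word_inv_reduced s : reduced s -> reduced (word_inv s).
Proof.
rewrite /reduced /word_inv rev_sorted sorted_map.
by apply: sub_sorted => x y /= xy; rewrite letter_invK eq_sym.
Qed.

Lemma word_mulVs s : word_mul (word_inv s) s = [::].
Proof.
elim: s => //= x s IHs.
rewrite /word_inv map_cons rev_cons /word_mul foldr_rcons /=.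
by rewrite letter_invK eqxx.
Qed.

Record freeGroup := FreeGroup { word : seq letter; _ : reduced word }.

HB.instance Definition _ := [isSub for word].
HB.instance Definition _ := [Choice of freeGroup by <:].

Lemma wordP (g : freeGroup) : reduced (word g).
Proof. exact: valP g. Qed.

Definition fg_one := @FreeGroup [::] isT.
Definition fg_inv g := FreeGroup (word_inv_reduced (wordP g)).
Definition fg_mul g h := FreeGroup (word_mul_reduced (word g) (wordP h)).

Lemma fg_mulA : associative fg_mul.
Proof. by move=> g h k; apply: val_inj; rewrite /= word_mulA// wordP. Qed.

Lemma fg_mul1 : left_id fg_one fg_mul.
Proof. by move=> g; apply: val_inj. Qed.

Lemma fg_muls1 : right_id fg_one fg_mul.
Proof. by move=> g; apply: val_inj; rewrite /= word_muls0// wordP. Qed.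

Lemma fg_mulV : left_inverse fg_one fg_inv fg_mul.
Proof. by move=> g; apply: val_inj; rewrite /= word_mulVs. Qed.

Lemma fg_mulsV : right_inverse fg_one fg_inv fg_mul.
Proof.
by move=> g; apply: val_inj; rewrite /= -{1}(word_invK (word g)) word_mulVs.
Qed.

HB.instance Definition _ :=
  isGroup.Build freeGroup fg_mulA fg_mul1 fg_muls1 fg_mulV fg_mulsV.

End FreeGroup.

(* Inner products are linear in the first argument and conjugate-linear in the
   second one. *)
HB.mixin Record CompleteNormedModule_isHilbert (C : numClosedFieldType) V
    of CompleteNormedModule C V := {
  inner : {dot V for (Num.conj : C -> C)};
  innerE : forall x : V, `|x| ^+ 2 = inner x x
}.

#[short(type="hilbertType")]
HB.structure Definition Hilbert (C : numClosedFieldType) :=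
  { V of CompleteNormedModule C V & CompleteNormedModule_isHilbert C V }.

Section Operators.
Variables (R : realType) (H : hilbertType R[i]).
Implicit Types T S : H -> H.

(* T belongs to B(H). *)
Definition bounded_op T : Prop :=
  linear T /\ exists M : R[i], forall x, `|T x| <= M * `|x|.

(* The norm of R[i], and hence of H, takes its values in R[i]. *)
Definition opnorm T : R := sup [set complex.Re `|T x| | x in [set x | `|x| <= 1]].

(* Adjoints are unique, and they exist for all T in B(H). *)
Definition adj T : H -> H :=
  xget (0 : H -> H) [set S | forall x y, inner (T x) y = inner x (S y)].

Definition unitary_op T : Prop :=
  [/\ linear T, forall x y, inner (T x) (T y) = inner x y
    & forall y, exists x, T x = y].

Definition finite_dimensional : Prop :=
  exists (d : nat) (e : 'I_d -> H),
    forall x, exists c : 'I_d -> R[i], x = \sum_i c i *: e i.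

End Operators.

Record unitary_rep (R : realType) (G : groupType) := UnitaryRep {
  rep_space :> hilbertType R[i];
  rep : G -> rep_space -> rep_space;
  rep_unitary : forall g, unitary_op (rep g);
  rep1 : rep 1%g = idfun;
  repM : forall g h, rep (g * h)%g = rep g \o rep h
}.

Arguments rep {R G} u g x.

Definition groupAlg (R : realType) (G : groupType) := {fsfun G -> R[i] with 0}.

(* The full group C*-algebra of a discrete group G is realised in the universal
   representation: its elements are families of operators indexed by all
   unitary representations of G (i.e. block-diagonal operators on the direct sum
   of the representation spaces), and C*(G) consists of the families that are
   norm limits of (the images of) elements of the group algebra.  The product
   and the involution that C*(G) induces on the group algebra are the usual
   convolution and the usual involution.  As opfamily quantifies over all Hilbert
   spaces, it is too large (in universe level) to be the carrier of a MathComp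
   structure, hence the explicit pointwise operations. *)
Section FullGroupCstarAlgebra.
Variables (R : realType) (G : groupType).

Definition opfamily : Type := forall rho : unitary_rep R G, rho -> rho.
Implicit Types a b : opfamily.

Definition fam_add a b : opfamily := fun rho => a rho + b rho.
Definition fam_scale (c : R[i]) a : opfamily := fun rho => c *: a rho.
Definition fam_mul a b : opfamily := fun rho => a rho \o b rho.
Definition fam_one : opfamily := fun rho => idfun.
Definition fam_star a : opfamily := fun rho => adj (a rho).

Definition universal_rep (f : groupAlg R G) : opfamily :=
  fun rho x => \sum_(g <- finsupp f) f g *: rep rho g x.

Arguments universal_rep f rho x : clear implicits.

Definition in_groupAlg a : Prop := exists f, a = universal_rep f.

(* The estimate is required for each rho, rather than for the supremum over rho,
   because sup has a default value on unbounded sets. *)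
Definition in_Cstar a : Prop :=
  (forall rho, bounded_op (a rho)) /\
  forall eps : R, 0 < eps -> exists f : groupAlg R G,
    forall rho, opnorm (a rho - universal_rep f rho) <= eps.

Definition Cstar_norm a : R := sup [set r | exists rho, r = opnorm (a rho)].

(* Unital *-homomorphisms from C*(G) to B(K). The values of phi outside C*(G) are
   irrelevant. *)
Definition is_representation (K : hilbertType R[i]) (phi : opfamily -> K -> K) :
    Prop :=
  [/\ forall a, in_Cstar a -> bounded_op (phi a),
      phi fam_one = idfun
    & [/\ forall a b, in_Cstar a -> in_Cstar b ->
            phi (fam_add a b) = phi a + phi b,
          forall c a, in_Cstar a -> phi (fam_scale c a) = c *: phi a,
          forall a b, in_Cstar a -> in_Cstar b ->
            phi (fam_mul a b) = phi a \o phi b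
        & forall a, in_Cstar a -> phi (fam_star a) = adj (phi a)]].

End FullGroupCstarAlgebra.

Arguments fam_add {R G} a b rho x.
Arguments fam_scale {R G} c a rho x.
Arguments fam_mul {R G} a b rho x.
Arguments fam_one R G rho x : clear implicits.
Arguments fam_star {R G} a rho x.
Arguments universal_rep {R G} f rho x.

(* Main.v *)
From HB Require Import structures.
Require Import Defs.
From mathcomp Require Import all_boot all_order all_algebra.
From mathcomp Require Import complex finmap sesquilinear.
From mathcomp Require Import ring.
From mathcomp Require Import all_classical all_reals all_analysis.

(** Let u be a free generator and let a be the sum of the geometric series
    1 + u/2 + u^2/4 + ..., that is, the inverse of 1 - u/2 in C*(F_n).

    - The coefficients are positive with sum 2. Hence every unitary
      representation maps a to an operator of norm at most 2, and the trivial
      representation, where u acts as 1, maps a to 2. So a attains its norm in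
      dimension one. The representation of C*(F_n) used for this is the
      evaluation of an operator family at the trivial representation.

    - The partial sums lie in the group algebra and converge to a uniformly in
      the representation, so a lies in C*(F_n) ([geom_in_Cstar]).

    - If a were in the group algebra, then the one-dimensional representations
      that send every generator to a number z of modulus 1 would give
      a Laurent polynomial p with (2 - z) p(z) = 2 on the unit circle. Clearing
      denominators gives an identity of polynomials, because the circle is
      infinite, and this identity fails at z = 2 ([geom_notin_groupAlg]).

    In each representation, the limit of the partial sums exists because the
    space is complete. The one-dimensional representations need the scalars
    as a Hilbert space, so the first part proves that R[i] is complete. *)

Set Implicit Arguments.
Unset Strict Implicit.
Unset Printing Implicit Defensive.

Import Order.TTheory GRing.Theory Num.Theory.
Import numFieldNormedType.Exports.

Local Open Scope classical_set_scope.
Local Open Scope ring_scope.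

(** * The complex numbers as a one-dimensional Hilbert space *)

Section ComplexLine.
Variable R : realType.
Local Notation C := (R[i]^o).

Lemma norm_i : `|('i%C : R[i])| = 1.
Proof. by rewrite normc_def /= expr0n add0r expr1n sqrtr1. Qed.

Lemma normc_le_ReDIm (z : R[i]) :
  `|z| <= (`|complex.Re z| + `|complex.Im z|)%:C%C.
Proof.
rewrite [in `|z|](complexE z) (le_trans (ler_normD _ _))// normrM norm_i mul1r.
by rewrite rmorphD /= !normc_def /= !expr0n !addr0 !sqrtr_sqr.
Qed.

(** The case of interest is that of the real and the imaginary part. *)
Lemma cauchy_contraction_cvg (F : set_system C) (f : C -> R^o) :
  ProperFilter F -> (forall x y, (`|f x - f y|)%:C%C <= `|x - y|) ->
  cauchy F -> cvg (f @ F).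
Proof.
move=> FF fle Fc.
have FFf : ProperFilter (f @ F) by exact: fmap_proper_filter.
apply: R_complete; apply: (@cauchy_exP R R^o) => e e0.
have e0C : 0 < e%:C%C by rewrite ltcR.
have [x Fx] := (@cauchyP R[i] C F FF).1 Fc _ e0C.
exists (f x); change (F (f @^-1` ball (f x) e)).
apply: filterS Fx => y xy; change (`|f x - f y| < e).
by rewrite -ltcR (le_lt_trans (fle _ _)).
Qed.

Lemma complex_complete (F : set_system C) :
  ProperFilter F -> cauchy F -> cvg F.
Proof.
move=> FF Fc.
have /cvg_ex [a Fa] : cvg ((@complex.Re R : C -> R^o) @ F).
  by apply: cauchy_contraction_cvg => // x y; rewrite -raddfB normc_ge_Re.
have /cvg_ex [b Fb] : cvg ((@complex.Im R : C -> R^o) @ F).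
  apply: cauchy_contraction_cvg => // x y; rewrite -raddfB /= -normrN -ReiNIm.
  by rewrite (le_trans (normc_ge_Re _))// normrM norm_i mulr1.
apply/cvg_ex; exists (a +i* b)%C; apply/cvgrPdist_lt => e e0.
have [e' e'0 ->] : exists2 e' : R, 0 < e' & e = e'%:C%C.
  have := RRe_real (gtr0_real e0) => ee; exists (complex.Re e) => //.
  by rewrite -ltcR ee.
move/cvgrPdist_lt: Fa => /(_ (e' / 2)) /(_ (divr_gt0 e'0 (ltr0n _ 2))) Fa.
move/cvgrPdist_lt: Fb => /(_ (e' / 2)) /(_ (divr_gt0 e'0 (ltr0n _ 2))) Fb.
have {}Fa : \forall x \near F, `|a - complex.Re x| < e' / 2 by exact: Fa.
have {}Fb : \forall x \near F, `|b - complex.Im x| < e' / 2 by exact: Fb.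
near=> x; apply: le_lt_trans (normc_le_ReDIm _) _; rewrite ltcR !raddfB /=.
by rewrite [ltRHS]splitr ltrD//; near: x.
Unshelve. all: by end_near. Qed.

(** A separate name for R[i]^o is needed because structure inference looks up
    completeness of T^o by its head symbol, where it finds the instance for
    real T. *)
Definition complex_line : Type := C.

HB.instance Definition _ := NormedModule.copy complex_line C.
HB.instance Definition _ := isPointed.Build complex_line 0.
HB.instance Definition _ :=
  Uniform_isComplete.Build complex_line complex_complete.

Definition scalar_inner (x y : R[i]) : R[i] := x * Num.conj y.

Lemma scalar_inner_bilinear :
  bilinear_for *%R ((Num.conj : R[i] -> R[i]) \; *%R)
    (scalar_inner : complex_line -> complex_line -> R[i]).
Proof.
split=> u a x y; rewrite /scalar_inner /=; first by rewrite mulrDl -mulrA.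
by rewrite rmorphD rmorphM mulrDr mulrCA.
Qed.

HB.instance Definition _ :=
  bilinear_isBilinear.Build R[i] complex_line complex_line R[i]
    *%R ((Num.conj : R[i] -> R[i]) \; *%R) scalar_inner scalar_inner_bilinear.

Lemma scalar_inner_hermitian (x y : complex_line) :
  scalar_inner x y = (-1) ^+ false * Num.conj (scalar_inner y x).
Proof. by rewrite /scalar_inner mul1r rmorphM /= conjCK mulrC. Qed.

HB.instance Definition _ := isHermitianSesquilinear.Build
  R[i] complex_line false Num.conj scalar_inner scalar_inner_hermitian.

Lemma scalar_inner_gt0 (x : complex_line) : x != 0 -> 0 < scalar_inner x x.
Proof. by rewrite /scalar_inner -normCK => x0; rewrite exprn_gt0 ?normr_gt0. Qed.

HB.instance Definition _ :=
  isDotProduct.Build R[i] complex_line scalar_inner scalar_inner_gt0.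

Lemma scalar_innerE (x : complex_line) : `|x| ^+ 2 = scalar_inner x x.
Proof. by rewrite normCK. Qed.

HB.instance Definition _ :=
  CompleteNormedModule_isHilbert.Build R[i] complex_line scalar_innerE.

End ComplexLine.

(** * The exponent sum on a free group *)

Section Exponent.
Variable n : nat.
Implicit Types (x : letter n) (s : seq (letter n)) (g h : freeGroup n).

Definition letter_sign x : int := if x.2 then 1 else -1.
Definition exponent g : int := \sum_(x <- word g) letter_sign x.

Lemma sum_push x s :
  \sum_(y <- push x s) letter_sign y =
  letter_sign x + \sum_(y <- s) letter_sign y.
Proof.
case: s => [|y s] /=; first by rewrite !big_cons.
case: eqP => [->|_]; rewrite ?big_cons// addrA.
by rewrite /letter_sign; case: x => i [] /=; rewrite ?subrr ?addNr add0r.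
Qed.

Lemma exponentM g h : exponent (g * h)%g = exponent g + exponent h.
Proof.
rewrite /exponent /= /word_mul; elim: (word g) => [|x s IHs] /=.
  by rewrite big_nil add0r.
by rewrite sum_push IHs big_cons addrA.
Qed.

Lemma exponent1 : exponent 1%g = 0.
Proof. by rewrite /exponent big_nil. Qed.

Definition generator (i : 'I_n) : freeGroup n := @FreeGroup n [:: (i, true)] isT.

Lemma exponent_generatorX i k : exponent (generator i ^+ k)%g = k.
Proof.
elim: k => [|k IHk]; first by rewrite expg0 exponent1.
by rewrite expgS exponentM IHk /exponent big_seq1 /letter_sign /= intS.
Qed.

Lemma generatorX_inj i : injective (fun k => generator i ^+ k)%g.
Proof.
by move=> k l /(congr1 exponent); rewrite !exponent_generatorX => -[].
Qed.

End Exponent.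

(** * One-dimensional representations of a free group *)

Section Character.
Variables (R : realType) (n : nat) (z : R[i]).
Hypothesis z1 : `|z| = 1.

Lemma unit_circle_neq0 : z != 0.
Proof. by rewrite -normr_eq0 z1 oner_eq0. Qed.

Definition chi (g : freeGroup n) (x : complex_line R) : complex_line R :=
  z ^ exponent g *: x.

Lemma chi_unitary g : unitary_op (chi g).
Proof.
have n1 : `|z ^ exponent g| = 1.
  case: (exponent g) => k; first by rewrite -exprnP normrX z1 expr1n.
  by rewrite NegzE -exprnN normfV normrX z1 expr1n invr1.
split=> [a x y|x y|y].
- by rewrite /chi scalerDr !scalerA mulrC.
- rewrite /inner /= /scalar_inner /chi /GRing.scale /= rmorphM /= mulrACA.
  by rewrite -normCK n1 expr1n mul1r.
- exists ((z ^ exponent g)^-1 *: y); rewrite /chi scalerA mulfV ?scale1r//.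
  by rewrite -normr_eq0 n1 oner_eq0.
Qed.

Lemma chi1 : chi 1%g = idfun.
Proof. by apply/funext => x; rewrite /chi exponent1 expr0z scale1r. Qed.

Lemma chiM g h : chi (g * h)%g = chi g \o chi h.
Proof.
apply/funext => x.
by rewrite /chi /= exponentM expfzDr ?unit_circle_neq0// scalerA.
Qed.

Definition character : unitary_rep R (freeGroup n) :=
  @UnitaryRep R (freeGroup n) (complex_line R) chi chi_unitary chi1 chiM.

End Character.

(** * Operator norms and evaluation at a representation *)

Section OpNorm.
Variables (R : realType) (H : hilbertType R[i]).
Implicit Types (T : H -> H) (M : R).

Lemma opnorm_ubound T M : 0 <= M -> (forall x, `|T x| <= M%:C%C * `|x|) ->
  ubound [set complex.Re `|T x| | x in [set x | `|x| <= 1]] M.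
Proof.
move=> M0 TM _ /= [x x1 <-].
have : `|T x| <= M%:C%C.
  by rewrite (le_trans (TM x))// ler_piMr// ler0c.
by rewrite lecE => /andP[].
Qed.

Lemma opnorm_le T M : 0 <= M -> (forall x, `|T x| <= M%:C%C * `|x|) ->
  opnorm T <= M.
Proof.
move=> M0 TM; apply: ge_sup; last exact: opnorm_ubound.
by exists (complex.Re `|T 0|), 0 => //=; rewrite normr0 ler01.
Qed.

End OpNorm.

(** The operations on operator families are pointwise. *)
Lemma evaluation_is_representation (R : realType) (G : groupType)
    (rho : unitary_rep R G) :
  is_representation (fun b : opfamily R G => b rho).
Proof. by split=> // b []. Qed.

(** * The geometric series of a group element *)

Lemma half_pow_lt (R : realType) (c e : R[i]) : 0 <= c -> 0 < e ->
  exists M, 2 * 2^-1 ^+ M * c < e.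
Proof.
move=> c0 e0.
have := RRe_real (gtr0_real e0); set e' := complex.Re e => ee.
have := RRe_real (ger0_real c0); set c' := complex.Re c => cc.
move: c0 e0; rewrite -ee -cc ler0c ltcR => c0 e0.
pose M := (Num.truncn (2 * c' / e')).+1; exists M.
have lt1 : 2 * c' / e' < 2 ^+ M.
  by rewrite (lt_trans (truncnS_gt _))// -natrX ltr_nat ltn_expl.
rewrite exprVn mulrAC ltr_pdivrMr ?exprn_gt0//.
move: lt1; rewrite ltr_pdivrMr// -ltcR !rmorphM /= rmorphXn /= rmorph_nat.
by rewrite [X in _ < X]mulrC.
Qed.

Section Geometric.
Variables (R : realType) (G : groupType) (u : G).
Implicit Types rho : unitary_rep R G.
Local Notation half := (2^-1 : R[i]).

Lemma rep_linear rho g : linear (rep rho g).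
Proof. by have [] := rep_unitary rho g. Qed.

Lemma rep_norm rho g x : `|rep rho g x| = `|x|.
Proof.
have [_ iso _] := rep_unitary rho g.
by apply: (pexpIrn (n := 2)); rewrite ?nnegrE// !innerE iso.
Qed.

Definition geom_partial rho N (x : rho) : rho :=
  \sum_(k < N) half ^+ k *: rep rho (u ^+ k)%g x.

Lemma geom_partial_linear rho N : linear (@geom_partial rho N).
Proof.
move=> a x y; rewrite /geom_partial scaler_sumr -big_split.
by apply: eq_bigr => k _; rewrite /= rep_linear scalerDr !scalerA mulrC.
Qed.

Lemma geom_partialS rho N x :
  geom_partial N.+1 x = x + half *: geom_partial N (rep rho u x).
Proof.
rewrite /geom_partial big_ord_recl expr0 expg0 rep1 scale1r; congr (_ + _).
rewrite scaler_sumr; apply: eq_bigr => k _.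
by rewrite lift0 scalerA exprS expgSr repM.
Qed.

Lemma geom_partial_tail rho M N (x : rho) : (M <= N)%N ->
  `|geom_partial N x - geom_partial M x| <= 2 * half ^+ M * `|x|.
Proof.
move=> /subnKC <-; move: (N - M)%N => j.
(* The exact value of the sum of the norms makes the induction on j go through. *)
apply: (@le_trans _ _ (2 * (half ^+ M - half ^+ (M + j)) * `|x|)); last first.
  by rewrite ler_wpM2r// ler_wpM2l// gerBl exprn_ge0// invr_ge0.
elim: j => [|j IHj]; first by rewrite addn0 !subrr normr0 mulr0 mul0r.
rewrite addnS /geom_partial big_ord_recr /= addrAC.
rewrite (le_trans (ler_normD _ _))// (le_trans (lerD IHj (lexx _)))//.
rewrite normrZ rep_norm ger0_norm ?exprn_ge0 ?invr_ge0// -mulrDl.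
rewrite ler_wpM2r// exprS le_eqVlt; apply/orP; left; apply/eqP.
by field.
Qed.

Lemma geom_partial_cvg rho (x : rho) : cvgn (fun N => geom_partial N x).
Proof.
apply: cauchy_cvg; apply: (@cauchy_exP R[i]) => e e0.
have [M Me] := half_pow_lt (normr_ge0 x) e0.
exists (geom_partial M x); exists M => // N /= MN.
by rewrite -ball_normE /= distrC; exact: le_lt_trans (geom_partial_tail _ MN) Me.
Qed.

Definition geom : opfamily R G :=
  fun rho x => lim (geom_partial N x @[N --> \oo]).
Arguments geom : clear implicits.

Lemma geom_linear rho : linear (geom rho).
Proof.
move=> a x y; apply: cvg_lim; first exact: norm_hausdorff.
under eq_fun do rewrite geom_partial_linear.
apply: cvgD; last exact: geom_partial_cvg.
by apply: cvgZr; exact: geom_partial_cvg.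
Qed.

(** This says that the series inverts 1 - u/2; it is the only information on the
    limit that the computation of its values in characters requires. *)
Lemma geom_equation rho (x : rho) :
  geom rho x = x + half *: geom rho (rep rho u x).
Proof.
apply: cvg_lim; first exact: norm_hausdorff.
rewrite -cvg_shiftS.
under eq_fun do rewrite geom_partialS.
by apply: cvgD; [exact: cvg_cst|apply: cvgZr; exact: geom_partial_cvg].
Qed.

Lemma geom_tail rho M (x : rho) :
  `|geom rho x - geom_partial M x| <= 2 * half ^+ M * `|x|.
Proof.
apply/ler_addgt0Pl => e e0.
have /cvgrPdist_le /(_ e e0) gx := geom_partial_cvg (x := x).
near \oo => N.
rewrite -[geom rho x](subrK (geom_partial N x)) -addrA.
rewrite (le_trans (ler_normD _ _))// lerD//; first by near: N.
by apply: geom_partial_tail; near: N; exact: nbhs_infty_ge.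
Unshelve. all: by end_near. Qed.

Lemma geom_norm_le rho (x : rho) : `|geom rho x| <= 2%:C%C * `|x|.
Proof.
have := geom_tail 0 x.
by rewrite /geom_partial big_ord0 subr0 expr0 mulr1 rmorph_nat.
Qed.

Lemma geom_bounded rho : bounded_op (geom rho).
Proof. by split; [exact: geom_linear|exists 2%:C%C; exact: geom_norm_le]. Qed.

(** When the powers of u are distinct, the coefficient function of a partial
    sum can be written down directly, with no collisions to add up. *)
Lemma geom_partial_in_groupAlg N : injective (fun k => u ^+ k)%g ->
  in_groupAlg (fun rho => @geom_partial rho N).
Proof.
move=> uinj.
pose s := [seq (u ^+ k)%g | k <- iota 0 N].
have us : uniq s by rewrite map_inj_uniq ?iota_uniq.
exists [fsfun g in [fset g in s]%fset => half ^+ index g s | 0].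
apply/functional_extensionality_dep => rho; apply/funext => x.
set f := [fsfun g in _ => _ | 0].
rewrite /universal_rep /geom_partial.
rewrite (@big_fset_incl _ _ _ _ _ [fset g in s]%fset).
- rewrite (perm_big s) /=; last first.
    by apply: uniq_perm => [||g]; [exact: fset_uniq| |rewrite !inE].
  rewrite big_map -[in RHS](subn0 N) big_mkord; apply: eq_bigr => k _.
  have ks : (u ^+ k)%g \in s by rewrite map_f// mem_iota /= ltn_ord.
  rewrite fsfun_fun !inE ks; congr (_ ^+ _ *: _).
  rewrite /s index_map//.
  have := @index_uniq _ 0 k (iota 0 N).
  by rewrite size_iota iota_uniq nth_iota// add0n => ->.
- exact: finsupp_sub.
- by move=> g _ /fsfun_dflt ->; rewrite scale0r.
Qed.

(** The tail estimate does not depend on the representation. *)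
Lemma geom_in_Cstar : injective (fun k => u ^+ k)%g -> in_Cstar geom.
Proof.
move=> uinj; split=> [rho|e e0]; first exact: geom_bounded.
have e0C : 0 < e%:C%C by rewrite ltcR.
have [M Me] := half_pow_lt ler01 e0C.
have [f fE] := geom_partial_in_groupAlg M uinj.
exists f => rho; apply: opnorm_le; first exact: ltW.
move=> x; rewrite -fE; apply: le_trans (geom_tail M x) _.
by rewrite ler_wpM2r// ltW// -[ltLHS]mulr1.
Qed.

End Geometric.

Arguments geom {R G} u rho x.

(** * The geometric series of a generator is not in the group algebra *)

(** The Cayley transforms (k + i)/(k - i) of the natural numbers k are
    infinitely many points of the unit circle. *)
Lemma poly_eq0_on_unit_circle (R : realType) (p : {poly R[i]}) :
  (forall z : R[i], `|z| = 1 -> root p z) -> p = 0.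
Proof.
move=> p0; apply/eqP/contraT => pn0.
pose cayley (k : nat) : R[i] := (k%:R + 'i%C) / (k%:R - 'i%C).
have natC k : k%:R = (k%:R)%:C%C :> R[i] by rewrite rmorph_nat.
have den k : k%:R - 'i%C != 0 :> R[i].
  by rewrite subr_eq0 natC eq_complex /= [0 == 1]eq_sym oner_eq0 andbF.
have cayley_norm k : `|cayley k| = 1.
  rewrite normf_div -[RHS](divff (x := `|k%:R - 'i%C|)) ?normr_eq0//.
  congr (_ / _); rewrite natC !normc_def /=; congr (Num.sqrt _)%:C%C.
  by rewrite !add0r subr0 addr0 sqrrN.
have cayley_inj : injective cayley.
  move=> k l /eqP; rewrite /cayley eqr_div// => /eqP kl.
  have : 2 * 'i%C * (l%:R - k%:R) = 0 :> R[i].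
    transitivity
      ((k%:R + 'i%C) * (l%:R - 'i%C) - (l%:R + 'i%C) * (k%:R - 'i%C) : R[i]).
      by ring.
    by rewrite kl subrr.
  move/eqP; rewrite !mulf_eq0 pnatr_eq0 subr_eq0 eqr_nat /=.
  by rewrite eq_complex /= oner_eq0 andbF => /eqP.
have := @max_poly_roots _ p [seq cayley k | k <- iota 0 (size p)] pn0.
rewrite map_inj_uniq// iota_uniq size_map size_iota ltnn => -> //.
by apply/allP => _ /mapP[k _ ->]; exact: p0.
Qed.

Section NotInGroupAlg.
Variables (R : realType) (n : nat) (i : 'I_n).
Local Notation u := (generator i).

Lemma geom_character (z : R[i]) (z1 : `|z| = 1) (x : complex_line R) :
  (2 - z) *: geom u (character n z1) x = 2 *: x.
Proof.
have gen y : rep (character n z1) u y = z *: y.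
  rewrite /= /chi.
  have -> : exponent u = 1 by rewrite -[u]expg1 exponent_generatorX.
  by rewrite expr1z.
have gz y : geom u (character n z1) (z *: y) = z *: geom u (character n z1) y.
  exact: (scalable_linear (geom_linear u (rho := character n z1))).
rewrite scalerBl {1}geom_equation gen gz scalerDr !scalerA mulrA.
by rewrite mulfV ?pnatr_eq0// mul1r addrK.
Qed.

Lemma geom_notin_groupAlg : ~ in_groupAlg (@geom R _ u).
Proof.
move=> [f fE].
(* Multiplication by the N-th power of z turns the Laurent polynomial with
   coefficients f g at the exponents of g into the polynomial p. *)
pose N : nat := \sum_(g <- finsupp f) `|exponent g|%N.
pose p : {poly R[i]} :=
  \sum_(g <- finsupp f) f g *: 'X^(`|(N%:Z + exponent g)%R|%N).
have pE (z : R[i]) : `|z| = 1 -> (2 - z) * p.[z] = 2 * z ^+ N.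
  move=> z1; have := geom_character z1 (1 : R[i]); rewrite fE.
  rewrite /GRing.scale /= mulr1 => eq2.
  rewrite -[in RHS]eq2 -mulrA; congr (_ * _).
  rewrite /p /universal_rep horner_sum mulr_suml; apply: eq_big_seq => g gf.
  have z0 := unit_circle_neq0 z1.
  rewrite !hornerE /= /chi /GRing.scale /= mulr1 -mulrA; congr (_ * _).
  rewrite exprnP gez0_abs ?expfzDr// 1?mulrC -?exprnP//.
  rewrite -lerBlDr sub0r (le_trans (ler_norm _))// normrN -abszE lez_nat.
  by rewrite /N (big_rem g)//= leq_addr.
have : (2%:P - 'X) * p - 2%:P * 'X^N = 0.
  apply: poly_eq0_on_unit_circle => z /pE pz.
  by rewrite rootE !hornerE pz subrr.
move/(congr1 (horner^~ 2)); rewrite !hornerE subrr mul0r sub0r => /eqP.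
by rewrite oppr_eq0 -exprS expf_eq0 pnatr_eq0.
Qed.

End NotInGroupAlg.

(** * The norm is attained at the trivial representation *)

Theorem corollary5p6 (R : realType) (n : nat) (n_gt0 : (0 < n)%N) :
  exists a : opfamily R (freeGroup n),
    [/\ in_Cstar a, ~ in_groupAlg a
      & exists (K : hilbertType R[i]) (phi : opfamily R (freeGroup n) -> K -> K),
          [/\ is_representation phi, finite_dimensional K
            & opnorm (phi a) = Cstar_norm a]].
Proof.
pose i := Ordinal n_gt0; pose a := @geom R _ (generator i).
pose triv := character n (normr1 R[i]).
have a_le rho : opnorm (a rho) <= 2.
  by apply: opnorm_le => //; exact: geom_norm_le.
have a_triv : opnorm (a triv) = 2.
  apply/eqP; rewrite eq_le a_le /=; apply: ub_le_sup.
    by exists 2; apply: (@opnorm_ubound _ triv) => //; exact: geom_norm_le.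
  exists (1 : R[i]); first by rewrite /= normr1.
  have := geom_character i (normr1 R[i]) (1 : R[i]).
  rewrite (_ : 2 - 1 = 1); last by rewrite (natrD _ 1 1) addrK.
  rewrite scale1r -/a -/triv => ->.
  change (complex.Re `|2 * 1 : R[i]| = 2).
  by rewrite mulr1 normr_nat -(rmorph_nat (real_complex R)).
exists a; split.
- by apply: geom_in_Cstar; exact: generatorX_inj.
- exact: geom_notin_groupAlg.
exists triv, (fun b => b triv); split.
- exact: evaluation_is_representation.
- exists 1%N, (fun=> 1 : R[i]) => x; exists (fun=> x : R[i]).
  by rewrite big_ord1 /GRing.scale /= mulr1.
- apply/eqP; rewrite a_triv eq_le; apply/andP; split.
    apply: ub_le_sup; last by exists triv.
    by exists 2 => _ [rho ->].
  apply: ge_sup; first by exists 2, triv.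
  by move=> _ [rho ->].
Qed.
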